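(* There is a strictly convex real Banach space of density continuum which does not admit an uncountable equilateral set.
   Context: The density of an infinite dimensional Banach space is the minimal cardinality of a norm dense subset. A subset $\mathcal{Y}$ of a Banach space is equilateral if there is $r>0$ such that $\|y-y'\|=r$ for any two distinct $y,y'\in\mathcal{Y}$. A norm is strictly convex if $\|x+y\|=\|x\|+\|y\|$ for nonzero $x,y$ implies $x=\lambda y$ for some $\lambda>0$. *)

(* Defs.v *)
From HB Require Import structures.
From mathcomp Require Import all_boot all_order all_algebra.
From mathcomp Require Import all_classical all_reals all_analysis.
Set Implicit Arguments.
Unset Strict Implicit.
Unset Printing Implicit Defensive.
Import Order.TTheory GRing.Theory Num.Theory.
Import numFieldNormedType.Exports.
Local Open Scope classical_set_scope.
Local Open Scope ring_scope.
Local Open Scope card_scope.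

(* A cardinal is represented by any set [K] of that cardinality. *)
Definition has_density (T : topologicalType) (U : Type) (K : set U) : Prop :=
  (exists2 D : set T, dense D & D #= K) /\
  (forall D : set T, dense D -> K #<= D).

Definition equilateral (R : realType) (X : normedModType R) (Y : set X) : Prop :=
  exists2 r : R, 0 < r &
    forall y y' : X, Y y -> Y y' -> y <> y' -> `|y - y'| = r.

Definition strictly_convex (R : realType) (X : normedModType R) : Prop :=
  forall x y : X, x <> 0 -> y <> 0 -> `|x + y| = `|x| + `|y| ->
    exists2 lambda : R, 0 < lambda & x = lambda *: y.

(* Main.v *)
(** Equip l1(R) with the norm |x| = |x|_1 + |x|_H, where |x|_H is the Hilbertian
norm sending x to its masses on the countably many intervals with rational
endpoints, weighted by powers of 1/2. These masses determine x, so |.|_H, hence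
the norm, is strictly convex; |.|_H is dominated by |.|_1, so the space stays
complete; and x is coded by countably many reals, so the space has continuum
many points, while the unit vectors are 1-separated.

Let Y be uncountable and r-equilateral. As |.|_H is a separable norm, Y has two
uncountable subsets at |.|_H-distance at least d > 0 from each other. For small
e, each of them has an uncountable subset Z of |.|_H-diameter at most e whose
elements are, up to e in |.|_1, carried by finite sets forming a delta-system
with root B on which they agree up to e. Two points of the same Z give
r <= 3e + 2s, where s is the |.|_1-mass of a point off B. Two points of different
subsets Z, Z' can be chosen almost disjoint off the roots, whence their distance
is at least s + s' - 4e + d > r, a contradiction. *)
Require Import Defs.
From HB Require Import structures.
From mathcomp Require Import all_boot all_order all_algebra.
From mathcomp Require Import all_classical all_reals all_analysis.
From mathcomp Require Import finmap ring lra.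
From mathcomp Require Import summability.
Set Implicit Arguments.
Unset Strict Implicit.
Unset Printing Implicit Defensive.
Import Order.TTheory GRing.Theory Num.Theory.
Import numFieldNormedType.Exports.
Local Open Scope classical_set_scope.
Local Open Scope ring_scope.

Local Existing Instance totally_filter.

(** * Absolutely summable families and their l1 norm *)

Section AbsolutelySummable.
Variables (T : choiceType) (R : realType).
Implicit Types (x y : T -> R) (F G : {fset T}).

Definition abs_summable x :=
  exists M, forall F, \sum_(t <- F) `|x t| <= M.

Definition l1_norm x := sup (range (fun F : {fset T} => \sum_(t <- F) `|x t|)).

Lemma l1_norm_has_sup x : abs_summable x ->
  has_sup (range (fun F : {fset T} => \sum_(t <- F) `|x t|)).
Proof.
move=> [M xM]; split; first by exists (\sum_(t <- fset0) `|x t|); exists fset0.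
by exists M => _ [F _ <-].
Qed.

Lemma le_l1_norm x F : abs_summable x -> \sum_(t <- F) `|x t| <= l1_norm x.
Proof. by move=> /l1_norm_has_sup xs; apply: sup_upper_bound => //; exists F. Qed.

Lemma l1_norm_le x M : (forall F, \sum_(t <- F) `|x t| <= M) -> l1_norm x <= M.
Proof.
move=> xM; apply: ge_sup; last by move=> _ [F _ <-].
by exists (\sum_(t <- fset0) `|x t|); exists fset0.
Qed.

Lemma le_coord_l1_norm x t : abs_summable x -> `|x t| <= l1_norm x.
Proof. by move=> /(@le_l1_norm _ [fset t]%fset); rewrite big_seq_fset1. Qed.

Lemma l1_norm_ge0 x : abs_summable x -> 0 <= l1_norm x.
Proof. by move=> /(@le_l1_norm _ fset0); rewrite big_seq_fset0. Qed.

Lemma abs_summable0 : abs_summable (0 : T -> R).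
Proof. by exists 0 => F; rewrite big1// => t _; rewrite normr0. Qed.

Lemma sum_normD_le x y F : abs_summable x -> abs_summable y ->
  \sum_(t <- F) `|x t + y t| <= l1_norm x + l1_norm y.
Proof.
move=> xs ys; apply: le_trans (lerD (le_l1_norm F xs) (le_l1_norm F ys)).
by rewrite -big_split; apply: ler_sum => t _; exact: ler_normD.
Qed.

Lemma abs_summableD x y :
  abs_summable x -> abs_summable y -> abs_summable (x + y).
Proof.
by move=> xs ys; exists (l1_norm x + l1_norm y) => F; exact: sum_normD_le.
Qed.

Lemma l1_normD x y : abs_summable x -> abs_summable y ->
  l1_norm (x + y) <= l1_norm x + l1_norm y.
Proof. by move=> xs ys; apply: l1_norm_le => F; exact: sum_normD_le. Qed.

Lemma abs_summable_le c x y : abs_summable y ->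
  (forall t, `|x t| <= c * `|y t|) -> abs_summable x.
Proof.
move=> [M yM] xy; exists (`|c| * M) => F.
apply: le_trans (ler_wpM2l (normr_ge0 c) (yM F)).
rewrite mulr_sumr; apply: ler_sum => t _; apply: le_trans (xy t) _.
by rewrite ler_wpM2r// ler_norm.
Qed.

Lemma abs_summableZ c x : abs_summable x -> abs_summable (c *: x).
Proof.
by move=> /(@abs_summable_le `|c|); apply=> t; rewrite /= normrM.
Qed.

Lemma l1_normZ_le c x : abs_summable x -> l1_norm (c *: x) <= `|c| * l1_norm x.
Proof.
move=> xs; apply: l1_norm_le => F.
apply: le_trans (ler_wpM2l (normr_ge0 c) (le_l1_norm F xs)).
by rewrite mulr_sumr; apply: ler_sum => t _; rewrite normrM.
Qed.

Lemma l1_normZ c x : abs_summable x -> l1_norm (c *: x) = `|c| * l1_norm x.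
Proof.
move=> xs; apply/le_anti; rewrite l1_normZ_le//=.
have [->|c0] := eqVneq c 0.
  by rewrite normr0 mul0r l1_norm_ge0//; exact: abs_summableZ.
(* The converse inequality is [l1_normZ_le] for [c^-1] and the family [c *: x]. *)
rewrite -ler_pdivlMl ?normr_gt0// -normfV.
by have := l1_normZ_le c^-1 (abs_summableZ c xs); rewrite scalerA mulVf// scale1r.
Qed.

Lemma l1_tail x e : abs_summable x -> 0 < e ->
  exists F, l1_norm x - e < \sum_(t <- F) `|x t|.
Proof.
by move=> xs e0; have [_ [F _ <-]] := sup_adherent e0 (l1_norm_has_sup xs); exists F.
Qed.

Lemma big_fsetU_disjoint (f : T -> R) F G : [disjoint F & G]%fset ->
  \sum_(t <- (F `|` G)%fset) f t = \sum_(t <- F) f t + \sum_(t <- G) f t.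
Proof.
move=> FG; rewrite (big_fsetID _ (mem F)) /=; congr +%R; apply: eq_fbigl => t.
  by rewrite !inE /=; case: (t \in F); rewrite ?andbF.
rewrite !inE /=; have [tF|] := boolP (t \in F); last by rewrite /= andbT.
by apply/esym/negbTE/(fdisjointP FG).
Qed.

(** Together, the disjoint sets [F] and [G] carry at most the whole norm, and [F] already carries
    all but [e] of it. *)
Lemma l1_tail_le x e F : abs_summable x ->
  l1_norm x - e < \sum_(t <- F) `|x t| ->
  forall G, [disjoint F & G]%fset -> \sum_(t <- G) `|x t| <= e.
Proof.
move=> xs xF G FG; have := le_l1_norm (F `|` G)%fset xs.
rewrite big_fsetU_disjoint// => ?; lra.
Qed.

Lemma sum_fsub_le (f : T -> R) F G : (forall t, 0 <= f t) -> (F `<=` G)%fset ->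
  \sum_(t <- F) f t <= \sum_(t <- G) f t.
Proof.
move=> f0 FG; rewrite (big_fsetID _ (mem F) G)/=.
rewrite (_ : [fset t in G | t \in F]%fset = F) ?lerDl; first exact: sumr_ge0.
apply/fsetP => t; rewrite !inE /=.
by have [/(fsubsetP FG) ->|] := boolP (t \in F); rewrite ?andbF.
Qed.

End AbsolutelySummable.

(** * Unconditional sums of absolutely summable families *)

Section UnconditionalSum.
Variables (T : choiceType) (R : realType).
Implicit Types (x y : T -> R) (F G : {fset T}).

Lemma partial_sum_fset x F : partial_sum x F = \sum_(t <- F) x t.
Proof. by rewrite /partial_sum big_seq_fsetE. Qed.

Lemma partial_sum_tail x e F G :
  (forall H, [disjoint F & H]%fset -> \sum_(t <- H) `|x t| <= e) ->
  (F `<=` G)%fset ->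
  `|\sum_(t <- F) x t - \sum_(t <- G) x t| <= e.
Proof.
move=> xF FG.
rewrite (big_fsetID _ (mem F) G)/= (_ : [fset t in G | t \in F]%fset = F); last first.
  apply/fsetP => t; rewrite !inE /=.
  by have [/(fsubsetP FG) ->|] := boolP (t \in F); rewrite ?andbF.
rewrite opprD addrA subrr add0r normrN.
apply: le_trans (ler_norm_sum _ _ _) _; apply: xF.
by apply/fdisjointP => t tF; rewrite !inE /= tF andbF.
Qed.

Lemma cvg_partial_sum x : abs_summable x ->
  partial_sum x @ totally --> (sum x : R^o).
Proof.
move=> xs; suff : cvg (partial_sum x @ totally : set_system R^o) by [].
apply: cauchy_cvg; apply: cauchy_exP => e e0.
have e20 : 0 < e / 2 by lra.
have [F xF] := l1_tail xs e20.
exists (\sum_(t <- F) x t); exists F => //= G FG.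
rewrite /ball /= partial_sum_fset.
by apply: le_lt_trans (partial_sum_tail (l1_tail_le xs xF) FG) _; lra.
Qed.

Lemma sum_tail x e F : abs_summable x ->
  (forall H, [disjoint F & H]%fset -> \sum_(t <- H) `|x t| <= e) ->
  `|sum x - \sum_(t <- F) x t| <= e.
Proof.
move=> xs xF; apply/ler_addgt0Pl => d d0.
have /cvgrPdist_le/(_ _ d0)[G _ xG] := cvg_partial_sum xs.
have := xG (F `|` G)%fset (fsubsetUr _ _); rewrite partial_sum_fset => x1.
have := partial_sum_tail xF (fsubsetUl F G).
by rewrite distrC; move: x1; rewrite !ler_norml; lra.
Qed.

Lemma sumD x y : abs_summable x -> abs_summable y ->
  sum (x + y) = sum x + sum y :> R.
Proof.
move=> xs ys; apply: (@cvg_lim R^o) => //.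
rewrite (_ : partial_sum _ = fun F => partial_sum x F + partial_sum y F).
  by apply: cvgD; exact: cvg_partial_sum.
by apply/funext => F; rewrite !partial_sum_fset -big_split.
Qed.

Lemma sumZ c x : abs_summable x -> sum (c *: x) = c * sum x :> R.
Proof.
move=> xs; apply: (@cvg_lim R^o) => //.
rewrite (_ : partial_sum _ = fun F => c * partial_sum x F).
  by apply: cvgMr; exact: cvg_partial_sum.
by apply/funext => F; rewrite !partial_sum_fset mulr_sumr.
Qed.

Lemma norm_sum_le x : abs_summable x -> `|sum x| <= l1_norm x.
Proof.
move=> xs; have := @sum_tail x (l1_norm x) fset0 xs.
by rewrite big_seq_fset0 subr0; apply=> H _; exact: le_l1_norm.
Qed.

End UnconditionalSum.

(** * Uncountable sets, pigeonhole and delta-systems *)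

Lemma countableU (U : Type) (A B : set U) :
  countable A -> countable B -> countable (A `|` B).
Proof.
move=> cA cB; rewrite -bigcup2inE; apply: bigcup_countable.
  exact: finite_set_countable.
by case=> [|[|]].
Qed.

Lemma uncountableD (U : Type) (A B : set U) :
  ~ countable A -> countable B -> ~ countable (A `\` B).
Proof.
move=> cA cB cAB; apply: cA.
apply: sub_countable (countableU cAB cB); apply: subset_card_le.
by move=> u Au; have [Bu|Bu] := pselect (B u); [right|left].
Qed.

Lemma uncountable_nonempty (U : Type) (A : set U) : ~ countable A -> A !=set0.
Proof. by move=> cA; apply/set0P/eqP => A0; apply: cA; rewrite A0; exact: countable0. Qed.

Lemma uncountable_fibre (U : Type) (C : countType) (f : U -> C) (Y : set U) :
  ~ countable Y -> exists c, ~ countable (Y `&` f @^-1` [set c]).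
Proof.
move=> cY; apply: contrapT => H; apply: cY.
rewrite (_ : Y = \bigcup_(c in [set: C]) (Y `&` f @^-1` [set c])).
  apply: bigcup_countable => // c _; apply: contrapT => nc; apply: H.
  by exists c.
by apply/seteqP; split=> [u Yu|u [c _ []]//]; exists (f u).
Qed.

(** A weak delta-system lemma: off the root the sets need not be disjoint, but each point lies in
    only countably many of them. Induction on the size: a point lying in uncountably many sets is
    moved to the root and removed from those sets; if there is no such point, the empty root
    works. *)
Lemma fset_delta_root (U : Type) (T : choiceType) (F : U -> {fset T}) (n : nat)
    (Y : set U) : ~ countable Y -> (forall u, Y u -> (#|` F u| <= n)%N) ->
  exists (B : {fset T}) (Z : set U), [/\ Z `<=` Y, ~ countable Z &
    forall t, t \notin B -> countable [set u | Z u /\ t \in F u]].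
Proof.
elim: n F Y => [|n IH] F Y cY FY.
  exists fset0, Y; split=> // t _.
  rewrite (_ : [set _ | _] = set0); first exact: countable0.
  apply/seteqP; split=> // u [/FY]; rewrite leqn0 cardfs_eq0 => /eqP ->.
  by rewrite inE.
have [H|/existsNP[t ct]] :=
    pselect (forall t, countable [set u | Y u /\ t \in F u]).
  by exists fset0, Y; split.
have [|B [Z [ZY cZ BZ]]] := IH (fun u => (F u `\ t)%fset) _ ct.
  by move=> u [/FY + tF]; rewrite (cardfsD1 t) tF.
exists (t |` B)%fset, Z; split=> // [u /ZY[]//|s].
rewrite !inE negb_or => /andP[st /BZ]; apply: sub_countable.
by apply: subset_card_le => u [Zu sF]; split=> //; rewrite !inE st.
Qed.

(** * Inner products and the equality case of the triangle inequality *)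

Definition inner_product (R : realType) (V : lmodType R) (B : V -> V -> R) :=
  [/\ forall x y z, B (x + y) z = B x z + B y z,
      forall c x z, B (c *: x) z = c * B x z,
      forall x y, B x y = B y x,
      forall x, 0 <= B x x
    & forall x, B x x = 0 -> x = 0].

Section InnerProduct.
Variables (R : realType) (V : lmodType R) (B : V -> V -> R).
Hypothesis BP : inner_product B.

Let BDl x y z : B (x + y) z = B x z + B y z. Proof. by case: BP. Qed.
Let BZl c x z : B (c *: x) z = c * B x z. Proof. by case: BP. Qed.
Let BC x y : B x y = B y x. Proof. by case: BP. Qed.
Let B_ge0 x : 0 <= B x x. Proof. by case: BP. Qed.
Let B_eq0 x : B x x = 0 -> x = 0. Proof. by case: BP => _ _ _ _; apply. Qed.

Let BZr c x z : B x (c *: z) = c * B x z.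
Proof. by rewrite BC BZl BC. Qed.

Let BDr x y z : B z (x + y) = B z x + B z y.
Proof. by rewrite BC BDl !(BC z). Qed.

Definition inner_norm x := Num.sqrt (B x x).

Lemma inner_norm_ge0 x : 0 <= inner_norm x.
Proof. exact: sqrtr_ge0. Qed.

Lemma sqr_inner_norm x : inner_norm x ^+ 2 = B x x.
Proof. by rewrite sqr_sqrtr. Qed.

Lemma inner_norm_eq0 x : inner_norm x = 0 -> x = 0.
Proof. by move=> x0; apply: B_eq0; rewrite -sqr_inner_norm x0 expr0n. Qed.

Lemma inner_norm_gt0 x : x <> 0 -> 0 < inner_norm x.
Proof.
move=> x0; rewrite lt_neqAle inner_norm_ge0 andbT eq_sym.
by apply/eqP => /inner_norm_eq0.
Qed.

Lemma inner_normZ c x : inner_norm (c *: x) = `|c| * inner_norm x.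
Proof. by rewrite /inner_norm BZl BZr mulrA -expr2 sqrtrM ?sqr_ge0// sqrtr_sqr. Qed.

(** One identity serves twice: nonnegativity of the left side gives Cauchy-Schwarz, and its
    vanishing gives the equality case. *)
Lemma inner_cross x y :
  B (inner_norm y *: x - inner_norm x *: y) (inner_norm y *: x - inner_norm x *: y)
  = 2 * inner_norm x * inner_norm y * (inner_norm x * inner_norm y - B x y).
Proof.
rewrite -scaleNr !(BDl, BDr, BZl, BZr) -!sqr_inner_norm (BC y x); ring.
Qed.

Lemma inner_le x y : B x y <= inner_norm x * inner_norm y.
Proof.
have [->|/eqP/inner_norm_gt0 x0] := eqVneq x 0.
  by rewrite -(scale0r 0) BZl mul0r mulr_ge0// inner_norm_ge0.
have [->|/eqP/inner_norm_gt0 y0] := eqVneq y 0.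
  by rewrite -(scale0r 0) BZr mul0r mulr_ge0// inner_norm_ge0.
have := B_ge0 (inner_norm y *: x - inner_norm x *: y).
by rewrite inner_cross pmulr_rge0 ?subr_ge0// !mulr_gt0.
Qed.

Lemma sqr_inner_normD x y : inner_norm (x + y) ^+ 2 =
  inner_norm x ^+ 2 + inner_norm y ^+ 2 + 2 * B x y.
Proof. rewrite !sqr_inner_norm !(BDl, BDr) (BC y x); ring. Qed.

Lemma inner_normD x y : inner_norm (x + y) <= inner_norm x + inner_norm y.
Proof.
rewrite -(@ler_pXn2r _ 2)// ?nnegrE ?addr_ge0 ?inner_norm_ge0//.
by rewrite sqr_inner_normD; have := inner_le x y; nra.
Qed.

(** Squaring the hypothesis gives equality in Cauchy-Schwarz, so the vector in [inner_cross] is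
    zero. *)
Lemma inner_normD_eq x y : inner_norm (x + y) = inner_norm x + inner_norm y ->
  inner_norm y *: x = inner_norm x *: y.
Proof.
move=> xy; apply/eqP; rewrite -subr_eq0; apply/eqP/B_eq0; rewrite inner_cross.
have := sqr_inner_normD x y; rewrite xy => H.
by rewrite (_ : _ - B x y = 0) ?mulr0//; lra.
Qed.

End InnerProduct.

(** * A weighted inner product on bounded sequences *)

Section WeightedDot.
Variable R : realType.
Implicit Types (u v w : R^nat) (M : R).

Definition bounded_seq u := exists M, forall n, `|u n| <= M.

(** The weights [2^-1 ^+ n.+1] have total 1, so a sequence bounded by [M] has square norm at most
    [M ^+ 2]. *)
Definition dot_term u v n : R := u n * v n * 2^-1 ^+ n.+1.

Definition wdot u v : R := limn (series (dot_term u v)).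

Lemma cvg_dot_term u v : bounded_seq u -> bounded_seq v ->
  cvgn (series (dot_term u v)).
Proof.
move=> [M uM] [N vN]; apply: normed_cvg.
apply: (@series_le_cvg _ _ (geometric (M * N / 2) 2^-1)).
- by move=> n; exact: normr_ge0.
- move=> n; rewrite /geometric/= mulr_ge0 ?exprn_ge0 ?divr_ge0 ?mulr_ge0//.
    exact: le_trans (uM 0).
  exact: le_trans (vN 0).
- move=> n; rewrite /dot_term /geometric /= exprS !normrM normfV normrX normfV !mulrA.
  rewrite (ger0_norm (ler0n _ 2)) ler_wpM2r ?exprn_ge0// ler_wpM2r//.
  exact: ler_pM.
- by apply: is_cvg_geometric_series; rewrite normfV ger0_norm//; lra.
Qed.

Lemma wdotC u v : wdot u v = wdot v u.
Proof.
rewrite /wdot (_ : dot_term u v = dot_term v u)//.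
by apply/funext => n; rewrite /dot_term (mulrC (u n)).
Qed.

Lemma wdotDl u v w : bounded_seq u -> bounded_seq v -> bounded_seq w ->
  wdot (u + v) w = wdot u w + wdot v w.
Proof.
move=> bu bv bw; rewrite /wdot -lim_seriesD; [|exact: cvg_dot_term..].
congr (limn (series _)); apply/funext => n.
by rewrite /dot_term/= !fctE -!mulrDl.
Qed.

Lemma wdotZl c u w : bounded_seq u -> bounded_seq w ->
  wdot (c *: u) w = c * wdot u w.
Proof.
move=> bu bw; rewrite -[RHS]/(c *: (wdot u w : R^o)) /wdot.
rewrite -lim_seriesZ; last exact: cvg_dot_term.
congr (limn (series _)); apply/funext => n.
by rewrite /dot_term/= !fctE -!mulrA.
Qed.

Lemma dot_term_ge0 u n : 0 <= dot_term u u n.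
Proof. by rewrite mulr_ge0 ?exprn_ge0// -expr2 sqr_ge0. Qed.

Lemma series_dot_le u n : bounded_seq u -> series (dot_term u u) n <= wdot u u.
Proof.
move=> bu; apply: nondecreasing_cvgn_le; last exact: cvg_dot_term.
by apply: nondecreasing_series => k _ _; exact: dot_term_ge0.
Qed.

Lemma dot_term_le u n : bounded_seq u -> dot_term u u n <= wdot u u.
Proof.
move=> bu; apply: le_trans (series_dot_le n.+1 bu).
rewrite /series/= big_nat_recr//= lerDr; apply: sumr_ge0 => k _.
exact: dot_term_ge0.
Qed.

Lemma wdot_ge0 u : bounded_seq u -> 0 <= wdot u u.
Proof. by move=> /(dot_term_le 0); apply: le_trans; exact: dot_term_ge0. Qed.

Lemma wdot_eq0 u n : bounded_seq u -> wdot u u = 0 -> u n = 0.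
Proof.
move=> /(dot_term_le n) + u0; rewrite u0 => un.
have /eqP : dot_term u u n = 0 by apply/le_anti; rewrite un dot_term_ge0.
by rewrite /dot_term -expr2 mulf_eq0 expf_eq0/= expf_eq0 invr_eq0 pnatr_eq0/= orbF => /eqP.
Qed.

(** The first [m] weights add up to at most 1 and the remaining ones to [2^-1 ^+ m]. With [m = 0]
    this compares the Hilbertian norm with the l1 norm; with [m] large it reduces closeness to
    finitely many coordinates. *)
Lemma wdot_le u m a M : 0 <= a -> (forall n, (n < m)%N -> `|u n| <= a) ->
  (forall n, `|u n| <= M) -> wdot u u <= a ^+ 2 + M ^+ 2 * 2^-1 ^+ m.
Proof.
move=> a0 ua uM; have bu : bounded_seq u by exists M.
have term_le c n : `|u n| <= c -> dot_term u u n <= c ^+ 2 * 2^-1 ^+ n.+1.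
  move=> uc; rewrite ler_wpM2r ?exprn_ge0// -expr2 -real_normK ?num_real//.
  by rewrite lerXn2r ?nnegrE// (le_trans _ uc).
(* The subtracted geometric remainder, here and in [tail], is what lets the induction pass. *)
have head n : (n <= m)%N ->
    series (dot_term u u) n <= a ^+ 2 - a ^+ 2 * 2^-1 ^+ n.
  elim: n => [_|n IH nm]; first by rewrite /series/= big_nil expr0 mulr1 subrr.
  rewrite /series/= big_nat_recr//=; have := IH (ltnW nm); rewrite /series/=.
  by have := term_le a n (ua _ nm); rewrite !(exprS 2^-1 n); lra.
have tail n : series (dot_term u u) (m + n)%N <=
    a ^+ 2 + M ^+ 2 * 2^-1 ^+ m - M ^+ 2 * 2^-1 ^+ (m + n).
  elim: n => [|n IH].
    rewrite addn0; have := head m (leqnn m).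
    have : 0 <= a ^+ 2 * 2^-1 ^+ m by rewrite mulr_ge0 ?sqr_ge0 ?exprn_ge0.
    lra.
  rewrite addnS /series/= big_nat_recr//=; move: IH; rewrite /series/=.
  by have := term_le M (m + n)%N (uM _); rewrite !(exprS 2^-1 (m + n)); lra.
apply: limr_le; first exact: cvg_dot_term.
exists m => //= n /= mn; rewrite -(subnKC mn); apply: le_trans (tail _) _.
by rewrite gerBl mulr_ge0 ?sqr_ge0 ?exprn_ge0.
Qed.

End WeightedDot.

(** * The space l1(R), its interval masses and its strictly convex norm *)

Section Ell1.
Variable R : realType.

Definition abs_summable_pred : {pred R -> R} := fun x => `[< abs_summable x >].

Lemma abs_summable_submod : submod_closed abs_summable_pred.
Proof.
split; first by apply/asboolP; exact: abs_summable0.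
move=> c x y /asboolP xs /asboolP ys; apply/asboolP.
by apply: abs_summableD => //; exact: abs_summableZ.
Qed.

HB.instance Definition _ :=
  GRing.isSubmodClosed.Build R (R -> R) abs_summable_pred abs_summable_submod.

(** The index set is the real line, so that rational intervals can tell the coordinates apart. As a
    subtype of [R -> R] the space inherits its linear structure. *)
Record ell1 := Ell1 {
  ell1_fun :> R -> R;
  ell1_funP : ell1_fun \in abs_summable_pred }.

HB.instance Definition _ := [isSub for ell1_fun].
HB.instance Definition _ := [Choice of ell1 by <:].
HB.instance Definition _ := [SubChoice_isSubLmodule of ell1 by <:].

Implicit Types (x y : ell1) (t : R).

Lemma ell1P x : abs_summable x.
Proof. by case: x => f /= /asboolP. Qed.

Lemma ell1_eqP x y : (forall t, x t = y t) -> x = y.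
Proof. by move=> xy; apply/val_inj/funext. Qed.

Lemma ell1D x y : ell1_fun (x + y) = ell1_fun x + ell1_fun y.
Proof. by []. Qed.

Lemma ell1Z c x : ell1_fun (c *: x) = c *: ell1_fun x.
Proof. by []. Qed.

Lemma ell1B x y : ell1_fun (x - y) = ell1_fun x - ell1_fun y.
Proof. by []. Qed.

Definition ell1_of (f : R -> R) (fs : abs_summable f) : ell1 := Ell1 (asboolT fs).

(** The indicator of the open interval whose endpoints are coded by [n]; an [n] that codes no pair
    gives the zero function. *)
Definition rat_itv (n : nat) t : R :=
  if (choice.unpickle n : option (rat * rat)) is Some (p, q) then (ratr p < t < ratr q)%R%:R
  else 0.

Lemma rat_itv_le1 n t : `|rat_itv n t| <= 1.
Proof.
rewrite /rat_itv; case: (choice.unpickle n : option (rat * rat)) => [[p q]|]; last by rewrite normr0.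
by case: (_ < _ < _); rewrite ?normr1 ?normr0.
Qed.

Definition itv_mass x n : R := sum (fun t => rat_itv n t * x t).

Lemma abs_summable_itv x n : abs_summable (fun t => rat_itv n t * x t).
Proof.
apply: (@abs_summable_le _ _ 1 _ x (ell1P x)) => t.
by rewrite normrM ler_wpM2r// rat_itv_le1.
Qed.

Lemma itv_massD x y : itv_mass (x + y) = itv_mass x + itv_mass y.
Proof.
apply/funext => n; rewrite /itv_mass !fctE -sumD; [|exact: abs_summable_itv..].
by congr sum; apply/funext => t; rewrite ell1D !fctE mulrDr.
Qed.

Lemma itv_massZ c x : itv_mass (c *: x) = c *: itv_mass x.
Proof.
apply/funext => n; rewrite /itv_mass !fctE -[RHS]sumZ; last exact: abs_summable_itv.
by congr sum; apply/funext => t; rewrite ell1Z !fctE mulrCA.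
Qed.

Lemma itv_massB x y : itv_mass (x - y) = itv_mass x - itv_mass y.
Proof. by rewrite itv_massD -scaleN1r itv_massZ scaleN1r. Qed.

Lemma itv_mass_le x n : `|itv_mass x n| <= l1_norm x.
Proof.
apply: le_trans (norm_sum_le (abs_summable_itv x n)) _.
apply: l1_norm_le => F; apply: le_trans (le_l1_norm F (ell1P x)).
apply: ler_sum => t _; rewrite normrM -[leRHS]mul1r ler_wpM2r//.
exact: rat_itv_le1.
Qed.

Lemma bounded_itv_mass x : bounded_seq (itv_mass x).
Proof. by exists (l1_norm x); exact: itv_mass_le. Qed.

(** The other points of the finite set [F] stay at distance at least some [d > 0] from [t], and
    rational endpoints are found within [d] on either side of [t]. *)
Lemma rat_itv_isolates t (F : {fset R}) :
  exists n, rat_itv n t = 1 /\ forall u, u \in F -> u != t -> rat_itv n u = 0.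
Proof.
have [d d0 Fd] : exists2 d, 0 < d & forall u, u \in F -> u != t -> d <= `|u - t|.
  have -> : (fun d => forall u, u \in F -> u != t -> d <= `|u - t|) =
      (fun d => forall u, u \in enum_fset F -> u != t -> d <= `|u - t|) by [].
  elim: (enum_fset F) => [|v s [d d0 sd]]; first by exists 1 => // u; rewrite in_nil.
  have [->|vt] := eqVneq v t.
    exists d => // u; rewrite in_cons => /orP[/eqP -> /eqP//|us].
    exact: sd us.
  exists (Num.min d `|v - t|); first by rewrite lt_min d0 normr_gt0 subr_eq0.
  move=> u; rewrite in_cons ge_min => /orP[/eqP -> _|us ut]; first by rewrite lexx orbT.
  by rewrite (sd _ us ut).
have [p] : exists p, ratr p \in `]t - d, t[ by apply: rat_in_itvoo; lra.
have [q] : exists q, ratr q \in `]t, t + d[ by apply: rat_in_itvoo; lra.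
rewrite !in_itv/= => /andP[tq qd] /andP[dp pt].
exists (choice.pickle (p, q)); rewrite /rat_itv choice.pickleK pt tq/=; split=> // u uF ut.
have := Fd u uF ut; rewrite ler_normr => dut.
case: (boolP (_ < u < _)) => // /andP[pu uq]; exfalso.
by case/orP: dut => ?; lra.
Qed.

(** If [x t] were nonzero, take a finite set carrying all but [|x t| / 2] of the norm and an
    interval isolating [t] from the rest of it: the mass of that interval is within [|x t| / 2] of
    [x t], hence nonzero. *)
Lemma itv_mass_eq0 x : (forall n, itv_mass x n = 0) -> x = 0.
Proof.
move=> x0; apply: ell1_eqP => t; have [//|xt] := eqVneq (x t) 0; exfalso.
have xt2 : 0 < `|x t| / 2 by rewrite divr_gt0 ?normr_gt0.
have [F xF] := l1_tail (ell1P x) xt2.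
have [n [nt nF]] := rat_itv_isolates t F.
(* Adjoining [t] keeps the tail bound and makes [x t] a term of the finite sum. *)
have {xF} xG : l1_norm x - `|x t| / 2 < \sum_(u <- (t |` F)%fset) `|x u|.
  by apply: lt_le_trans xF _; apply: sum_fsub_le => //; exact: fsubsetUr.
have : `|itv_mass x n - x t| <= `|x t| / 2.
  have xtE : x t = \sum_(u <- (t |` F)%fset) rat_itv n u * x u.
    rewrite (big_fsetD1 t)/= ?fset1U1// nt mul1r big_seq big1 ?addr0// => u.
    by rewrite !inE => /andP[ut]; rewrite (negbTE ut)/= => uF; rewrite nF// mul0r.
  rewrite [X in _ - X]xtE; apply: sum_tail; first exact: abs_summable_itv.
  move=> H /(l1_tail_le (ell1P x) xG) xH; apply: le_trans xH.
  apply: ler_sum => u _; rewrite normrM -[leRHS]mul1r ler_wpM2r//.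
  exact: rat_itv_le1.
rewrite x0 sub0r normrN; lra.
Qed.

Definition ell1_inner x y : R := wdot (itv_mass x) (itv_mass y).

Lemma ell1_innerP : inner_product ell1_inner.
Proof.
split=> [x y z|c x z|x y|x|x].
- by rewrite /ell1_inner itv_massD wdotDl//; exact: bounded_itv_mass.
- by rewrite /ell1_inner itv_massZ wdotZl//; exact: bounded_itv_mass.
- exact: wdotC.
- by apply: wdot_ge0; exact: bounded_itv_mass.
- move=> x0; apply: itv_mass_eq0 => n; apply: wdot_eq0 x0.
  exact: bounded_itv_mass.
Qed.

Definition ell1_hilb x := inner_norm ell1_inner x.

Lemma ell1_hilb_ge0 x : 0 <= ell1_hilb x.
Proof. exact: inner_norm_ge0. Qed.

Lemma ell1_hilb_le x m (a M : R) : 0 <= a ->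
  (forall n, (n < m)%N -> `|itv_mass x n| <= a) ->
  (forall n, `|itv_mass x n| <= M) ->
  ell1_hilb x ^+ 2 <= a ^+ 2 + M ^+ 2 * 2^-1 ^+ m.
Proof.
move=> a0 xa xM; rewrite (sqr_inner_norm ell1_innerP).
exact: wdot_le.
Qed.

Lemma ell1_hilb_le_l1 x : ell1_hilb x <= l1_norm x.
Proof.
have x0 := l1_norm_ge0 (ell1P x).
rewrite -(@ler_pXn2r _ 2)// ?nnegrE ?ell1_hilb_ge0//.
have := @ell1_hilb_le x 0 0 (l1_norm x) (lexx 0).
by rewrite expr0n add0r expr0 mulr1; apply=> // n; exact: itv_mass_le.
Qed.

(** A single term bounds the whole series from below; this turns a gap between two masses into a
    Hilbertian distance. *)
Lemma itv_mass_le_hilb x n : itv_mass x n ^+ 2 * 2^-1 ^+ n.+1 <= ell1_hilb x ^+ 2.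
Proof.
rewrite (sqr_inner_norm ell1_innerP).
by rewrite expr2; apply: dot_term_le; exact: bounded_itv_mass.
Qed.

Definition ell1_norm x := l1_norm x + ell1_hilb x.

Lemma ell1_normD x y : ell1_norm (x + y) <= ell1_norm x + ell1_norm y.
Proof.
rewrite /ell1_norm addrACA lerD//; first exact: l1_normD (ell1P x) (ell1P y).
exact: inner_normD ell1_innerP _ _.
Qed.

Lemma ell1_normZ c x : ell1_norm (c *: x) = `|c| * ell1_norm x.
Proof.
rewrite /ell1_norm mulrDr -(l1_normZ c (ell1P x)); congr +%R.
exact: inner_normZ ell1_innerP _ _.
Qed.

Lemma ell1_norm_eq0 x : ell1_norm x = 0 -> x = 0.
Proof.
move=> xN; apply: (inner_norm_eq0 ell1_innerP).
have := l1_norm_ge0 (ell1P x); have := ell1_hilb_ge0 x.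
by move: xN; rewrite /ell1_norm /ell1_hilb; lra.
Qed.

HB.instance Definition _ :=
  Lmodule_isNormed.Build R ell1 ell1_normD ell1_normZ ell1_norm_eq0.

Lemma ell1_normE x : `|x| = l1_norm x + ell1_hilb x.
Proof. by []. Qed.

(** Both summands of the norm satisfy the triangle inequality, so equality for the sum forces
    equality for the Hilbertian one. *)
Lemma ell1_strictly_convex : strictly_convex ell1.
Proof.
move=> x y x0 y0; rewrite !ell1_normE => xy.
have S0 := inner_norm_gt0 ell1_innerP.
have : inner_norm ell1_inner y *: x = inner_norm ell1_inner x *: y.
  apply: (inner_normD_eq ell1_innerP).
  have := l1_normD (ell1P x) (ell1P y).
  have : ell1_hilb (x + y) <= ell1_hilb x + ell1_hilb y.
    exact: inner_normD ell1_innerP _ _.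
  rewrite -ell1D; move: xy; rewrite /ell1_hilb; lra.
move=> e; exists (inner_norm ell1_inner x / inner_norm ell1_inner y).
  by rewrite divr_gt0// S0.
by rewrite mulrC -scalerA -e scalerA mulVf ?scale1r// gt_eqF// S0.
Qed.

End Ell1.

(** * Completeness *)

Section Ell1Complete.
Variable R : realType.
Implicit Types (x y : ell1 R) (t : R).

Lemma coord_le_norm x t : `|x t| <= `|x|.
Proof.
apply: le_trans (le_coord_l1_norm t (ell1P x)) _.
by rewrite ell1_normE lerDl; exact: ell1_hilb_ge0.
Qed.

Lemma sum_coord_le_norm x (F : {fset R}) : \sum_(t <- F) `|x t| <= `|x|.
Proof.
apply: le_trans (le_l1_norm F (ell1P x)) _.
by rewrite ell1_normE lerDl; exact: ell1_hilb_ge0.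
Qed.

Lemma ell1_complete (F : set_system (ell1 R)) : ProperFilter F -> cauchy F -> cvg F.
Proof.
move=> FF /cauchyP Fc.
(* The candidate limit is taken coordinate by coordinate. *)
have /choice[l xl] t : exists l : R, (fun x : ell1 R => x t) @ F --> (l : R^o).
  suff : cvg ((fun x : ell1 R => x t) @ F : set_system R^o).
    by move=> /cvg_ex[l]; exists l.
  apply: cauchy_cvg; apply: cauchy_exP => e /Fc[x xe].
  exists (x t); suff : F [set y : ell1 R | ball (x t : R^o) e (y t)] by [].
  apply: filterS xe => y.
  rewrite -!ball_normE /= => xy; apply: le_lt_trans xy; exact: (coord_le_norm (x - y) t).
(* A bound on a finite sum survives the coordinatewise limit; taking it over all finite sets bounds
   the l1 norm. *)
have tail x e : F (ball x e) -> forall G : {fset R}, \sum_(t <- G) `|x t - l t| <= e.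
  move=> xe G; apply: (@cvgr_to_le _ F _ _ (fun y : ell1 R => \sum_(t <- G) `|x t - y t|)).
    apply: (@cvg_big R^o) => [|t _].
      by apply: add_continuous.
    by apply: cvg_norm; apply: cvgB; [exact: cvg_cst|exact: xl].
  apply: filterS xe => y; rewrite -ball_normE /= => /ltW; apply: le_trans.
  exact: (sum_coord_le_norm (x - y)).
have ls : abs_summable l.
  have [x xe] := Fc 1 ltr01; exists (1 + `|x|) => G.
  apply: le_trans (lerD (tail x 1 xe G) (sum_coord_le_norm x G)).
  rewrite -big_split; apply: ler_sum => t _.
  rewrite -[X in `|X|](subrK (x t)) -(normrN (x t - l t)) opprB.
  exact: ler_normD.
apply/cvg_ex; exists (ell1_of ls); apply/cvgrPdist_lt => e e0.
(* The radius is [e / 4] because the full norm is at most twice the l1 norm. *)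
have [|x xe] := Fc (e / 4); first lra.
have le4 : `|x - ell1_of ls| <= e / 2.
  rewrite ell1_normE; have := ell1_hilb_le_l1 (x - ell1_of ls).
  have : l1_norm (x - ell1_of ls) <= e / 4 by apply: l1_norm_le; exact: tail.
  lra.
apply: filterS xe => y; rewrite -ball_normE /= => xy.
rewrite -normrN opprB in le4.
have := ler_normD (ell1_of ls - x) (x - y).
by rewrite addrA subrK => /le_lt_trans; apply; lra.
Qed.

HB.instance Definition _ := Uniform_isComplete.Build (ell1 R) ell1_complete.

End Ell1Complete.

(** * Coding sets of naturals by real numbers *)

Lemma injective_card_le (U V : Type) (f : U -> V) (A : set V) :
  injective f -> (forall u, A (f u)) -> ([set: U] #<= A)%card.
Proof.
move=> fI fA; have fT : (f @` [set: U] #= [set: U])%card.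
  by apply: inj_card_eq => u v _ _; exact: fI.
by rewrite -(card_le_eql fT); apply: subset_card_le => _ [u _ <-].
Qed.

Section TernaryCode.
Variable R : realType.
Implicit Type S : set nat.

(** Digits 0 and 1 are read in base 3: a digit 1 at place [k] contributes [3^-k], while all later
    digits contribute at most half of that, so distinct sets get distinct values. *)
Definition ternary_sum S n : R := \sum_(0 <= k < n) (k \in S)%:R * 3^-1 ^+ k.

Lemma ternary_sumS S n :
  ternary_sum S n.+1 = ternary_sum S n + (n \in S)%:R * 3^-1 ^+ n.
Proof. by rewrite /ternary_sum big_nat_recr. Qed.

Lemma ternary_sum_le S m n : ternary_sum S (m + n) <=
  ternary_sum S m + 3 / 2 * 3^-1 ^+ m - 3 / 2 * 3^-1 ^+ (m + n).
Proof.
elim: n => [|n IH]; first by rewrite addn0 addrK.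
rewrite addnS ternary_sumS exprS.
have : 0 <= (3^-1 : R) ^+ (m + n) by rewrite exprn_ge0 ?invr_ge0.
by case: (_ \in S); rewrite ?mul0r ?mul1r; lra.
Qed.

Lemma ternary_sum_bound S m n : ternary_sum S n <=
  ternary_sum S m + 3 / 2 * 3^-1 ^+ m.
Proof.
have p k : 0 <= (3^-1 : R) ^+ k by rewrite exprn_ge0 ?invr_ge0.
apply: (@le_trans _ _ (ternary_sum S (m + n))); last first.
  by have := ternary_sum_le S m n; have := p (m + n)%N; lra.
elim: m => // m IH; rewrite addSn ternary_sumS; apply: le_trans IH _.
by rewrite lerDl mulr_ge0.
Qed.

Definition ternary S : R := sup (range (ternary_sum S)).

Lemma ternary_le S m : ternary S <= ternary_sum S m + 3 / 2 * 3^-1 ^+ m.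
Proof.
apply: ge_sup; first by exists (ternary_sum S 0); exists 0%N.
by move=> _ [n _ <-]; exact: ternary_sum_bound.
Qed.

Lemma ternary_ge S m : ternary_sum S m <= ternary S.
Proof.
apply: sup_upper_bound; last by exists m.
split; first by exists (ternary_sum S 0); exists 0%N.
by exists (ternary_sum S 0 + 3 / 2 * 3^-1 ^+ 0) => _ [n _ <-]; exact: ternary_sum_bound.
Qed.

Lemma ternary_inj : injective ternary.
Proof.
(* At the first place of disagreement, [ternary S] gains [3^-k], which the later digits of [S']
   cannot make up for. *)
have sub S S' k : ternary S = ternary S' ->
    (forall j, (j < k)%N -> (j \in S) = (j \in S')) -> k \in S -> k \in S'.
  move=> SS' jS kS; apply: contraT => kS'; exfalso.
  have := ternary_ge S k.+1; have := ternary_le S' k.+1; rewrite SS'.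
  rewrite !ternary_sumS kS (negbTE kS') exprS mul1r mul0r.
  have -> : ternary_sum S k = ternary_sum S' k.
    by apply: eq_big_nat => j /andP[_ /jS ->].
  have : 0 < (3^-1 : R) ^+ k by rewrite exprn_gt0 ?invr_gt0.
  lra.
move=> S S' SS'; suff H k : (k \in S) = (k \in S').
  by apply/seteqP; split=> k /mem_set; rewrite (H, =^~ H) => /set_mem.
elim/ltn_ind: k => k IH; apply/idP/idP; apply: sub => // j jk; exact/esym/IH.
Qed.

End TernaryCode.

(** * The density is the continuum *)

Section Ell1Density.
Variable R : realType.
Implicit Types (x y : ell1 R) (t : R).

(** The Dedekind cuts of all the masses of [x], packed into one set of naturals. *)
Definition mass_cut x : set nat := [set n |
  if (choice.unpickle n : option (nat * rat)) is Some (i, q)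
  then ratr q < itv_mass x i else False].

Lemma mass_cut_inj : injective mass_cut.
Proof.
move=> x y xy; apply/subr0_eq/itv_mass_eq0 => i.
suff : itv_mass x i = itv_mass y i.
  by rewrite itv_massB !fctE => ->; rewrite subrr.
have lt_cut z w : mass_cut z = mass_cut w -> itv_mass z i <= itv_mass w i.
  move=> zw; rewrite leNgt; apply/negP => /rat_in_itvoo[q].
  rewrite in_itv/= => /andP[wq qz].
  have : mass_cut z (choice.pickle (i, q)) by rewrite /mass_cut /= choice.pickleK.
  by rewrite zw /mass_cut/= choice.pickleK => /(lt_trans wq); rewrite ltxx.
by apply/le_anti; rewrite !lt_cut.
Qed.

Lemma unit_abs_summable t : abs_summable (fun u : R => (u == t)%:R : R).
Proof.
exists 1 => F; have [tF|tF] := boolP (t \in F).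
  rewrite (big_fsetD1 t)//= eqxx normr1 big_seq big1 ?addr0// => u.
  by rewrite !inE => /andP[/negbTE -> _]; rewrite normr0.
rewrite big_seq big1 // => u uF; case: eqVneq uF tF => [->|_ _ _].
  by move=> ->.
by rewrite normr0.
Qed.

Definition ell1_unit t := ell1_of (unit_abs_summable t).

Lemma ell1_unit_separated s t : s != t -> 1 <= `|ell1_unit s - ell1_unit t|.
Proof.
move=> st; apply: le_trans (coord_le_norm (ell1_unit s - ell1_unit t) s).
by rewrite ell1B !fctE /= eqxx (negbTE st) subr0 normr1.
Qed.

Lemma ell1_density : has_density (ell1 R) [set: R].
Proof.
have large (D : set (ell1 R)) : dense D -> ([set: R] #<= D)%card.
  move=> dD.
  (* Balls of radius [1 / 2] about the unit vectors are disjoint, so their chosen points in [D] are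
     distinct. *)
  have /choice[d dP] t : exists d, D d /\ ball (ell1_unit t) (1 / 2) d.
    have [||d [bd Dd]] := dD (ball (ell1_unit t) (1 / 2)).
    - by exists (ell1_unit t); apply: ballxx; rewrite divr_gt0.
    - exact: ball_open.
    by exists d.
  have dI : injective d.
    move=> s t dst; apply/eqP; apply: contraT => st; exfalso.
    have := ell1_unit_separated st.
    have [_ bs] := dP s; have [_ bt] := dP t; rewrite -dst in bt.
    by have := ball_splitl bs bt; rewrite -ball_normE /=; lra.
  by apply: injective_card_le dI _ => t; case: (dP t).
(* The whole space serves as the dense set: it injects into [R] through [mass_cut] and [ternary]. *)
split=> //; exists [set: ell1 R]; first by move=> O O0 _; rewrite setIT.
rewrite card_eq_le large ?andbT; last by move=> O O0 _; rewrite setIT.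
by apply: (@injective_card_le _ _ (@ternary R \o mass_cut)) => //;
  exact: inj_comp (@ternary_inj R) mass_cut_inj.
Qed.

End Ell1Density.

(** * Equilateral sets are countable *)

Section Ell1Equilateral.
Variable R : realType.
Implicit Types (x y z : ell1 R) (t e : R) (F G B : {fset R}).

Lemma floor_close e (a b : R) : 0 < e ->
  Num.floor (a / e) = Num.floor (b / e) -> `|a - b| <= e.
Proof.
move=> e0 ab; have := floor_itv (a / e); have := floor_itv (b / e).
rewrite ab intrD => /andP[b1 b2] /andP[a1 a2].
suff : `|a / e - b / e| <= 1.
  by rewrite -mulrBl normrM normfV (gtr0_norm e0) ler_pdivrMr// mul1r.
by rewrite ler_norml; apply/andP; split; lra.
Qed.

Lemma half_expr_small e (M : R) : 0 < e -> exists m, M * 2^-1 ^+ m <= e.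
Proof.
move=> e0; have := truncnS_gt (`|M| / e); set m := _.+1 => Mm; exists m; move: Mm.
rewrite ltr_pdivrMr// exprVn => Mm.
rewrite ler_pdivrMr ?exprn_gt0//; apply: le_trans (ler_norm M) _.
apply: le_trans (ltW Mm) _; rewrite mulrC ler_pM2l//.
by rewrite -natrX ler_nat ltnW// ltn_expl.
Qed.

(** Separability of the Hilbertian norm, phrased as a countable code. The integer part of the l1
    norm bounds all masses and so fixes how many of them matter; these are rounded to a grid of step
    [e / 2]. *)
Lemma hilb_code e : 0 < e -> exists f : ell1 R -> nat * seq int,
  forall x y, f x = f y -> ell1_hilb (x - y) <= e.
Proof.
(* The head contributes [(e / 2) ^+ 2] and the tail at most [e ^+ 2 / 2], together below
   [e ^+ 2]. *)
move=> e0; have h k : exists m, (2 * k.+1%:R) ^+ 2 * 2^-1 ^+ m <= (e ^+ 2) / 2 :> R.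
  by apply: half_expr_small; rewrite divr_gt0// exprn_gt0.
have {h} [m mP] := choice h.
pose k x := Num.truncn (l1_norm x).
pose f x := (k x, [seq Num.floor (itv_mass x n / (e / 2)) | n <- iota 0 (m (k x))]).
exists f => x y [kxy]; rewrite -kxy => fxy.
rewrite -(@ler_pXn2r _ 2)// ?nnegrE ?ell1_hilb_ge0//; last exact: ltW.
apply: (@le_trans _ _ ((e / 2) ^+ 2 + (2 * (k x).+1%:R) ^+ 2 * 2^-1 ^+ m (k x))).
  apply: ell1_hilb_le => [|n nm|n]; first lra.
    rewrite itv_massB; apply: floor_close; first lra.
    have := congr1 (nth 0 ^~ n) fxy.
    by rewrite !(nth_map 0%N) ?size_iota// !nth_iota.
  rewrite itv_massB; apply: le_trans (ler_normB _ _) _.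
  have := itv_mass_le x n; have := itv_mass_le y n.
  have := truncnS_gt (l1_norm x); have := truncnS_gt (l1_norm y).
  rewrite -/(k x) -/(k y) -kxy; lra.
have := mP (k x); have : 0 <= e ^+ 2 by rewrite sqr_ge0.
rewrite (exprMn _ e); lra.
Qed.

Lemma coord_code B e : 0 < e -> exists f : ell1 R -> seq int,
  forall x y, f x = f y -> \sum_(t <- B) `|x t - y t| <= e.
Proof.
move=> e0; pose c := e / (size B).+1%:R.
exists (fun x => [seq Num.floor (x t / c) | t <- B]) => x y /eq_in_map fxy.
apply: (@le_trans _ _ (\sum_(t <- B) c)).
  rewrite big_seq [leRHS]big_seq; apply: ler_sum => t tB.
  by apply: floor_close; [rewrite divr_gt0|exact: fxy].
rewrite big_const_seq count_predT iter_addr addr0 -mulr_natr /c mulrAC.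
by rewrite ler_pdivrMr// ler_pM2l// ler_nat.
Qed.

Definition off_mass B x := l1_norm x - \sum_(t <- B) `|x t|.

Lemma off_mass_ge B G x : [disjoint B & G]%fset ->
  \sum_(t <- G) `|x t| <= off_mass B x.
Proof.
move=> BG; rewrite lerBrDl -big_fsetU_disjoint//; exact: le_l1_norm (ell1P x).
Qed.

Lemma fdisjoint_fsetD (G B : {fset R}) : [disjoint B & G `\` B]%fset.
Proof. by apply/fdisjointP => t tB; rewrite inE tB. Qed.

Lemma sum_fsetDI (f : R -> R) G B : (forall t, 0 <= f t) ->
  \sum_(t <- G) f t <= \sum_(t <- B) f t + \sum_(t <- (G `\` B)%fset) f t.
Proof.
move=> f0; rewrite -big_fsetU_disjoint ?fdisjoint_fsetD//; apply: sum_fsub_le => //.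
by apply/fsubsetP => t tG; rewrite !inE tG andbT orbN.
Qed.

Lemma l1_normB_le_off B x y : l1_norm (x - y) <=
  \sum_(t <- B) `|x t - y t| + off_mass B x + off_mass B y.
Proof.
apply: l1_norm_le => G.
apply: le_trans (@sum_fsetDI (fun t => `|(x - y : ell1 R) t|) G B _) _ => //.
rewrite -addrA lerD2l.
have BG := fdisjoint_fsetD G B.
apply: le_trans (lerD (off_mass_ge x BG) (off_mass_ge y BG)).
by rewrite -big_split; apply: ler_sum => t _; exact: ler_normB.
Qed.

(** On [F] off [B], [x] has mass at least its off-root mass minus [e], and [y] has mass at most [e];
    symmetrically on [F'] off [B']. These two sets are disjoint, so the bounds add up with a loss of
    [4 * e]. *)
Lemma off_mass_le_l1_normB e x y (F F' B B' : {fset R}) :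
  l1_norm x - e < \sum_(t <- F) `|x t| ->
  l1_norm y - e < \sum_(t <- F') `|y t| ->
  [disjoint F `\` B & F']%fset -> [disjoint F' `\` B' & B]%fset ->
  off_mass B x + off_mass B' y - 4 * e <= l1_norm (x - y).
Proof.
move=> xF yF' GF' G'B; set G := (F `\` B)%fset; set G' := (F' `\` B')%fset.
(* A point of [F] lies in [B], which [G'] avoids, or in [G], which avoids [F']. *)
have G'F : [disjoint F & G']%fset.
  apply/fdisjointP => t tF; apply/negP => tG'.
  have tF' : t \in F' by move: tG'; rewrite inE => /andP[].
  have tB := fdisjointP G'B _ tG'.
  by have := fdisjointP GF' t; rewrite inE tB tF tF' => /(_ isT).
have GG' : [disjoint G & G']%fset.
  by apply: fdisjointWl G'F; exact: fsubsetDl.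
have xG' := l1_tail_le (ell1P x) xF G'F.
have yG : \sum_(t <- G) `|y t| <= e.
  by apply: (l1_tail_le (ell1P y) yF'); rewrite fdisjoint_sym.
have xG := @sum_fsetDI (fun t => `|x t|) F B (fun _ => normr_ge0 _).
have yG' := @sum_fsetDI (fun t => `|y t|) F' B' (fun _ => normr_ge0 _).
have := le_l1_norm (G `|` G')%fset (ell1P (x - y)).
rewrite big_fsetU_disjoint//.
have h1 : \sum_(t <- G) `|x t| - \sum_(t <- G) `|y t| <=
    \sum_(t <- G) `|(x - y : ell1 R) t|.
  by rewrite -sumrB; apply: ler_sum => t _; exact: lerB_dist.
have h2 : \sum_(t <- G') `|y t| - \sum_(t <- G') `|x t| <=
    \sum_(t <- G') `|(x - y : ell1 R) t|.
  by rewrite -sumrB; apply: ler_sum => t _; rewrite ell1B distrC; exact: lerB_dist.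
move: xG yG'; rewrite -/G -/G' /off_mass; lra.
Qed.

(** Each of the finitely many points of [H] off [B] excludes only countably many [z]. *)
Lemma exists_disjoint_fset (Z : set (ell1 R)) (F : ell1 R -> {fset R}) B H :
  ~ countable Z ->
  (forall t, t \notin B -> countable [set z | Z z /\ t \in F z]) ->
  exists2 z, Z z & [disjoint F z `\` B & H]%fset.
Proof.
move=> cZ FB; pose bad := \bigcup_(t in [set` (H `\` B)%fset]) [set z | Z z /\ t \in F z].
have cbad : countable bad.
  apply: bigcup_countable; first exact: countable_fset.
  by move=> t /=; rewrite inE => /andP[tB _]; exact: FB.
have [z [Zz zbad]] := uncountable_nonempty (uncountableD cZ cbad).
exists z => //; apply/fdisjointP => t; rewrite inE => /andP[tB tF].
by apply/negP => tH; apply: zbad; exists t => //=; rewrite inE tB.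
Qed.

Lemma uncountable_refine e (F : ell1 R -> {fset R}) (Y : set (ell1 R)) :
  0 < e -> ~ countable Y ->
  exists (B : {fset R}) (Z : set (ell1 R)), [/\ Z `<=` Y, ~ countable Z,
    forall t, t \notin B -> countable [set z | Z z /\ t \in F z]
  & forall z w, Z z -> Z w -> [/\ ell1_hilb (z - w) <= e,
      \sum_(t <- B) `|z t - w t| <= e & `|off_mass B z - off_mass B w| <= e]].
Proof.
move=> e0 cY.
(* Fixing the cardinality of [F z] gives the uniform bound that [fset_delta_root] requires. *)
have [n cYn] := uncountable_fibre (fun z => #|` F z|) cY.
have [|B [Z [ZY cZ FB]]] := @fset_delta_root _ _ F n _ cYn.
  by move=> z [_ /= ->].
have [f fP] := hilb_code e0; have [g gP] := coord_code B e0.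
have [c cZc] := uncountable_fibre
  (fun z => (f z, g z, Num.floor (off_mass B z / e))) cZ.
exists B; eexists; split; [|exact: cZc| |].
- by move=> z [/ZY[]].
- move=> t /FB; apply: sub_countable; apply: subset_card_le.
  by move=> z [[]].
move=> z w [_ zc] [_ wc]; move: zc; rewrite -wc => -[fzw gzw ozw].
by split; [exact: fP|exact: gP|exact: floor_close].
Qed.

(** Discard from [Y] all countable pieces cut out by a rational bound on one mass. Two remaining
    points differ in some mass; with rationals [p < q] strictly between its two values, the pieces
    below [p] and above [q] each contain a remaining point, hence are uncountable. *)
Lemma uncountable_split (Y : set (ell1 R)) : ~ countable Y ->
  exists (Y1 Y2 : set (ell1 R)) (d : R), [/\ Y1 `<=` Y, Y2 `<=` Y,
    ~ countable Y1, ~ countable Y2 & 0 < d /\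
    forall x y, Y1 x -> Y2 y -> d <= ell1_hilb (x - y)].
Proof.
move=> cY.
pose lo (p : nat * rat) := Y `&` [set y | itv_mass y p.1 <= ratr p.2].
pose hi (p : nat * rat) := Y `&` [set y | ratr p.2 <= itv_mass y p.1].
pose thin (A : nat * rat -> set (ell1 R)) := \bigcup_(p in [set p | countable (A p)]) A p.
have thinc A : countable (thin A) by apply: bigcup_countable.
have cY' := uncountableD (uncountableD cY (thinc lo)) (thinc hi).
have [x xP] := uncountable_nonempty cY'.
have [y [yP yx]] := uncountable_nonempty (uncountableD cY' (countable1 x)).
have thick a b n : ((Y `\` thin lo) `\` thin hi) a -> ((Y `\` thin lo) `\` thin hi) b ->
    itv_mass a n < itv_mass b n ->
    exists (Y1 Y2 : set (ell1 R)) (d : R), [/\ Y1 `<=` Y, Y2 `<=` Y,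
    ~ countable Y1, ~ countable Y2 & 0 < d /\
    forall x y, Y1 x -> Y2 y -> d <= ell1_hilb (x - y)].
  move=> [[Ya alo] _] [[Yb _] bhi] /rat_in_itvoo[p]; rewrite in_itv/= => /andP[ap pb].
  have [q] := rat_in_itvoo pb; rewrite in_itv/= => /andP[pq qb].
  exists (lo (n, p)), (hi (n, q)), (Num.sqrt ((ratr q - ratr p) ^+ 2 * 2^-1 ^+ n.+1)).
  split; [by move=> ? []|by move=> ? []| | |split].
  - by move=> c; apply: alo; exists (n, p) => //; split=> //; exact: ltW.
  - by move=> c; apply: bhi; exists (n, q) => //; split=> //; exact: ltW.
  - by rewrite sqrtr_gt0 mulr_gt0// exprn_gt0 ?subr_gt0 ?invr_gt0.
  move=> z w [_ /= zp] [_ /= wq].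
  rewrite -[leRHS](ger0_norm (ell1_hilb_ge0 _)) -sqrtr_sqr ler_sqrt ?sqr_ge0//.
  apply: le_trans (itv_mass_le_hilb (z - w) n); rewrite ler_wpM2r ?exprn_ge0//.
  by rewrite itv_massB !fctE; nra.
have : exists n, itv_mass x n != itv_mass y n.
  apply: contrapT => /forallNP xy; apply: yx; apply/esym/subr0_eq/itv_mass_eq0 => n.
  rewrite itv_massB !fctE.
  by have /negP := xy n; rewrite negbK => /eqP ->; rewrite subrr.
by move=> [n]; rewrite neq_lt => /orP[]; exact: thick.
Qed.

Lemma ell1_no_uncountable_equilateral (Y : set (ell1 R)) :
  equilateral Y -> countable Y.
Proof.
move=> [r r0 Yr]; apply: contrapT => cY.
have [Y1 [Y2 [d [Y1Y Y2Y cY1 cY2 [d0 dP]]]]] := uncountable_split cY.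
(* Averaging the two bounds from [half] gives [r <= 3 * e + s + s'], so the distance is at least
   [s + s' - 4 * e + d >= r - 7 * e + d], which exceeds [r] when [d = 8 * e]. *)
pose e := d / 8; have e0 : 0 < e by rewrite /e; lra.
have [F FP] := choice (fun z => l1_tail (ell1P z) e0).
have half (B : {fset R}) (Z : set (ell1 R)) : Z `<=` Y -> ~ countable Z ->
    (forall z w, Z z -> Z w -> [/\ ell1_hilb (z - w) <= e,
      \sum_(t <- B) `|z t - w t| <= e & `|off_mass B z - off_mass B w| <= e]) ->
    forall z, Z z -> r <= 3 * e + 2 * off_mass B z.
  move=> ZY cZ ZP z Zz.
  have [w [Zw wz]] := uncountable_nonempty (uncountableD cZ (countable1 z)).
  rewrite -(Yr z w (ZY _ Zz) (ZY _ Zw) (fun zw => wz (esym zw))) ell1_normE.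
  have [h1 h2 h3] := ZP z w Zz Zw; have := l1_normB_le_off B z w.
  by move: h3; rewrite ler_norml => /andP[]; lra.
have [B [Z [ZY1 cZ FB ZP]]] := uncountable_refine F e0 cY1.
have [B' [Z' [ZY2 cZ' FB' ZP']]] := uncountable_refine F e0 cY2.
(* The order matters: [z'] is chosen to avoid the root [B], then [z] to avoid the finite set
   [F z']. *)
have [z' Zz' z'B] := exists_disjoint_fset B cZ' FB'.
have [z Zz zz'] := exists_disjoint_fset (F z') cZ FB.
have hd := dP z z' (ZY1 _ Zz) (ZY2 _ Zz').
have lz := half B Z (subset_trans ZY1 Y1Y) cZ ZP z Zz.
have lz' := half B' Z' (subset_trans ZY2 Y2Y) cZ' ZP' z' Zz'.
have ll := off_mass_le_l1_normB (FP z) (FP z') zz' z'B.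
have zNz' : z <> z'.
  move=> zz; have : `|z - z'| = 0 by rewrite zz subrr normr0.
  by rewrite ell1_normE; have := l1_norm_ge0 (ell1P (z - z')); lra.
have := Yr z z' (Y1Y _ (ZY1 _ Zz)) (Y2Y _ (ZY2 _ Zz')) zNz'.
by rewrite ell1_normE; move: ll lz lz' hd; rewrite /e; lra.
Qed.

End Ell1Equilateral.

Theorem theorem2 (R : realType) :
  exists X : completeNormedModType R,
    [/\ strictly_convex X,
        has_density X [set: R]
      & ~ exists Y : set X, equilateral Y /\ ~ countable Y].
Proof.
exists (ell1 R); split; first exact: ell1_strictly_convex.
  exact: ell1_density.
by move=> [Y [/ell1_no_uncountable_equilateral]].
Qed.
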